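(* In the setting of the context, suppose platform profit $\Pi(p,v)$ and welfare $W(p,v)$ are concave in $p$. Let $$\Omega(p)\equiv W_p(p,v)-\Pi_p(p,v)=N\,r'(p)\,e(p)+(1-\omega)T'(p)-D'(p).$$ Then: 1. if $\Omega(p)\ge 0$ for every $p\in[0,1)$, the origin is weakly too closed: $p^P(v)\le p^S(v)$; 2. if $\Omega(p)\le 0$ for every $p\in[0,1)$, the origin is weakly too open: $p^P(v)\ge p^S(v)$; 3. if $\Omega$ changes sign, there is no global ordering (of $p^P(v)$ and $p^S(v)$) without additional curvature restrictions. The inequalities are strict for interior solutions when the corresponding wedge is strict.
   Context: An origin platform chooses a portability entitlement $p\in[0,1]$ for given verification reliability $v\in[0,1]$. There are $N\ge 2$ developers, $c>0$. $F'>0$, $F''\le 0$, $G'>0$, $G''\le 0$. The outside-return function $r$ satisfies $r'>0$, $r''\le 0$, $r(0)=r_0\ge 0$; each developer's induced investment is $e=e(p)=r(p)/c$. $C(p)$ (real conversion cost), $T(p)$ (competitive leakage) and $H(p)$ (transfer-harm function) satisfy $C',T',H'\ge 0$ and $H(0)=0$; the verification cost $k(v)$ satisfies $k'>0$, $k''>0$. $\omega\in[0,1)$ is the share of leakage $T$ that is a real resource cost rather than redistribution, and $D(p)$ collects additional duplicated-infrastructure, fragmentation or cross-platform security cost that the origin does not internalize. Platform profit and welfare, both evaluated at $e=e(p)$, are $$\Pi(p,v)=NF(e)+G(Ne)-N r(p)e-C(p)-T(p)-H(p)(1-v)-k(v),$$ $$W(p,v)=NF(e)+G(Ne)-\frac{Nc}{2}e^2-C(p)-H(p)(1-v)-k(v)-\omega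 T(p)-D(p).$$ Subscript $p$ denotes the derivative in $p$. It is a standing assumption of the model that $\Pi(\cdot,v)$ is strictly concave in $p$. $p^P(v)$ denotes the profit-maximizing (private) and $p^S(v)$ the welfare-maximizing (social) portability level in $[0,1]$. The ''wedge'' is $\Omega$, and it is strict when the corresponding inequality on $\Omega$ is strict. *)

(* Defs.v *)
From Stdlib Require Import Reals ClassicalEpsilon.
Open Scope R_scope.

Definition unit_itv (x : R) : Prop := 0 <= x <= 1.
Definition nneg (x : R) : Prop := 0 <= x.

(* Derivatives are taken relative to the domain [S], hence are one-sided at
   its end points.  [deriv_on] is unspecified where no derivative exists, so it
   is only meaningful together with [derivable_on]. *)
Definition derivable_on (S : R -> Prop) (f : R -> R) : Prop :=
  forall x, S x -> exists l, D_in f (fun _ => l) S x.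

Definition deriv_on (S : R -> Prop) (f : R -> R) (x : R) : R :=
  epsilon (inhabits 0) (fun l => D_in f (fun _ => l) S x).

Definition twice_derivable_on (S : R -> Prop) (f : R -> R) : Prop :=
  derivable_on S f /\ derivable_on S (deriv_on S f).

Definition concave01 (f : R -> R) : Prop :=
  forall x y t, unit_itv x -> unit_itv y -> unit_itv t ->
    t * f x + (1 - t) * f y <= f (t * x + (1 - t) * y).

Definition strictly_concave01 (f : R -> R) : Prop :=
  forall x y t, unit_itv x -> unit_itv y -> x <> y -> 0 < t < 1 ->
    t * f x + (1 - t) * f y < f (t * x + (1 - t) * y).

Definition argmax01 (f : R -> R) (p : R) : Prop :=
  unit_itv p /\ forall q, unit_itv q -> f q <= f p.

Record economy := Economy {
  Ndev : nat;        (* number of developers *)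
  cinv : R;          (* investment cost parameter c *)
  omega : R;         (* real-resource share of leakage *)
  Fdev : R -> R;
  Gagg : R -> R;
  rret : R -> R;     (* outside return *)
  Cconv : R -> R;    (* conversion cost *)
  Tleak : R -> R;    (* competitive leakage *)
  Hharm : R -> R;    (* transfer harm *)
  Ddup : R -> R;     (* costs not internalized by the origin *)
  kver : R -> R      (* verification cost *)
}.

Definition investment (E : economy) (p : R) : R := rret E p / cinv E.

Definition profit (E : economy) (v p : R) : R :=
  let e := investment E p in let N := INR (Ndev E) in
  N * Fdev E e + Gagg E (N * e) - N * rret E p * e
  - Cconv E p - Tleak E p - Hharm E p * (1 - v) - kver E v.

Definition welfare (E : economy) (v p : R) : R :=
  let e := investment E p in let N := INR (Ndev E) in
  N * Fdev E e + Gagg E (N * e) - N * cinv E / 2 * e ^ 2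
  - Cconv E p - Hharm E p * (1 - v) - kver E v
  - omega E * Tleak E p - Ddup E p.

(* [D] carries no sign or monotonicity restriction. *)
Record standing (E : economy) : Prop := Standing {
  N_ge2 : (2 <= Ndev E)%nat;
  c_pos : 0 < cinv E;
  omega_range : 0 <= omega E < 1;
  F_reg : twice_derivable_on nneg (Fdev E);
  F_incr : forall x, nneg x -> 0 < deriv_on nneg (Fdev E) x;
  F_conc : forall x, nneg x -> deriv_on nneg (deriv_on nneg (Fdev E)) x <= 0;
  G_reg : twice_derivable_on nneg (Gagg E);
  G_incr : forall x, nneg x -> 0 < deriv_on nneg (Gagg E) x;
  G_conc : forall x, nneg x -> deriv_on nneg (deriv_on nneg (Gagg E)) x <= 0;
  r_reg : twice_derivable_on unit_itv (rret E);
  r_incr : forall p, unit_itv p -> 0 < deriv_on unit_itv (rret E) p;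
  r_conc : forall p, unit_itv p ->
    deriv_on unit_itv (deriv_on unit_itv (rret E)) p <= 0;
  r_zero : 0 <= rret E 0;
  C_reg : derivable_on unit_itv (Cconv E);
  C_incr : forall p, unit_itv p -> 0 <= deriv_on unit_itv (Cconv E) p;
  T_reg : derivable_on unit_itv (Tleak E);
  T_incr : forall p, unit_itv p -> 0 <= deriv_on unit_itv (Tleak E) p;
  H_reg : derivable_on unit_itv (Hharm E);
  H_incr : forall p, unit_itv p -> 0 <= deriv_on unit_itv (Hharm E) p;
  H_zero : Hharm E 0 = 0;
  D_reg : derivable_on unit_itv (Ddup E);
  k_reg : twice_derivable_on unit_itv (kver E);
  k_incr : forall v, unit_itv v -> 0 < deriv_on unit_itv (kver E) v;
  k_conv : forall v, unit_itv v ->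
    0 < deriv_on unit_itv (deriv_on unit_itv (kver E)) v;
  profit_sconc : forall v, unit_itv v -> strictly_concave01 (profit E v)
}.

Definition objectives_concave (E : economy) (v : R) : Prop :=
  concave01 (profit E v) /\ concave01 (welfare E v).

Definition wedge (E : economy) (v p : R) : R :=
  deriv_on unit_itv (welfare E v) p - deriv_on unit_itv (profit E v) p.

(* Exactly the failure of both one-signed cases on [0,1). *)
Definition wedge_changes_sign (E : economy) (v : R) : Prop :=
  (exists p, 0 <= p < 1 /\ 0 < wedge E v p) /\
  (exists p, 0 <= p < 1 /\ wedge E v p < 0).

(* The private level is unique by strict concavity; the social one need not be,
   since welfare is only assumed concave. *)
Definition private_level (E : economy) (v p : R) : Prop := argmax01 (profit E v) p.
Definition social_level (E : economy) (v p : R) : Prop := argmax01 (welfare E v) p.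

Definition levels_exist (E : economy) (v : R) : Prop :=
  (exists pP, private_level E v pP) /\ (exists pS, social_level E v pS).

Definition strictly_too_closed (E : economy) (v : R) : Prop :=
  levels_exist E v /\
  forall pP pS, private_level E v pP -> social_level E v pS -> pP < pS.

Definition strictly_too_open (E : economy) (v : R) : Prop :=
  levels_exist E v /\
  forall pP pS, private_level E v pP -> social_level E v pS -> pS < pP.

(* The primitives entering N r' e + (1 - omega) T' - D'; two economies sharing
   them have the same wedge, whatever F, G, C, H and k are. *)
Definition same_wedge_primitives (E E' : economy) : Prop :=
  Ndev E' = Ndev E /\ cinv E' = cinv E /\ omega E' = omega E /\
  rret E' = rret E /\ Tleak E' = Tleak E /\ Ddup E' = Ddup E.

(* Main.v *)
(* Welfare minus profit is [wedge_integral], so the wedge is a derivative and the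
   mean value theorem turns its sign into a comparison of welfare gains with
   profit gains between the two optima; strictness comes from first-order
   conditions at a common interior optimum.  For a sign-changing wedge, adding
   [A x] to [F] and [B p] to [C] moves the private optimum to any chosen point
   without touching the wedge: a point of positive wedge gives [pP < pS], an
   interior point of negative wedge (one exists since the wedge is a derivative)
   gives [pS < pP]. *)
Require Import Defs.
From Stdlib Require Import Reals Lra Lia ClassicalEpsilon.
Open Scope R_scope.

(** * Derivatives relative to a set *)

(** Gives uniqueness of relative derivatives: at an isolated point of [S] every value satisfies
    [D_in], and [deriv_on] would carry no information. *)
Definition dense_in_itself (S : R -> Prop) : Prop :=
  forall x, S x -> adhDa (D_x S x) x.

Lemma nneg_dense_in_itself : dense_in_itself nneg.
Proof.
  unfold nneg; intros x Hx a Ha; exists (x + a / 2); split.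
  - split; lra.
  - unfold Rdist; rewrite Rabs_pos_eq; lra.
Qed.

Lemma unit_itv_dense_in_itself : dense_in_itself unit_itv.
Proof.
  unfold unit_itv; intros x Hx a Ha.
  assert (H1 := Rmin_l a 1); assert (H2 := Rmin_r a 1).
  assert (H3 : 0 < Rmin a 1) by (apply Rmin_glb_lt; lra).
  (* The step has length at most 1/2 and goes towards the farther end point, so it stays in the
     interval. *)
  destruct (Rle_lt_dec x (1 / 2)).
  - exists (x + Rmin a 1 / 2); unfold D_x, Rdist; rewrite Rabs_pos_eq by lra; lra.
  - exists (x - Rmin a 1 / 2); unfold D_x, Rdist; rewrite Rabs_left by lra; lra.
Qed.

(** Since some derivative exists, [epsilon] returns a genuine one, and uniqueness of limits
    identifies it with [l]. *)
Lemma deriv_on_eq (S : R -> Prop) (f : R -> R) (x l : R) :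
  dense_in_itself S -> S x -> D_in f (fun _ => l) S x -> deriv_on S f x = l.
Proof.
  intros HS Sx Hl.
  apply (single_limit _ _ _ _ _ (HS x Sx)) with (2 := Hl).
  exact (epsilon_spec (inhabits 0) (fun l => D_in f (fun _ => l) S x)
           (ex_intro _ l Hl)).
Qed.

Lemma deriv_on_spec (S : R -> Prop) (f : R -> R) (x : R) :
  derivable_on S f -> S x -> D_in f (deriv_on S f) S x.
Proof.
  intros Hf Sx.
  exact (epsilon_spec (inhabits 0) (fun l => D_in f (fun _ => l) S x) (Hf x Sx)).
Qed.

(** The difference quotient at [x] sees only values on [S], and of [d] only [d x] enters the
    limit. *)
Lemma D_in_congr (S : R -> Prop) (f g d d' : R -> R) (x : R) :
  S x -> (forall y, S y -> f y = g y) -> d x = d' x ->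
  D_in f d S x -> D_in g d' S x.
Proof.
  intros Sx Hfg Hd Hf eps Heps.
  destruct (Hf eps Heps) as [a [Ha H]]; exists a; split; [exact Ha|].
  intros y [[Sy Hy] Hyx]; rewrite <- Hd, <- !Hfg by assumption.
  apply H; repeat split; assumption.
Qed.

Lemma derivable_on_of (S : R -> Prop) (f d : R -> R) :
  (forall x, S x -> D_in f d S x) -> derivable_on S f.
Proof. intros H x Sx; exists (d x); exact (H x Sx). Qed.

Lemma deriv_on_of (S : R -> Prop) (f d : R -> R) (x : R) :
  dense_in_itself S -> S x -> D_in f d S x -> deriv_on S f x = d x.
Proof. intros HS Sx H; apply deriv_on_eq; assumption. Qed.

Lemma twice_derivable_on_of (S : R -> Prop) (f d dd : R -> R) :
  dense_in_itself S ->
  (forall x, S x -> D_in f d S x) -> (forall x, S x -> D_in d dd S x) ->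
  twice_derivable_on S f /\
  (forall x, S x -> deriv_on S f x = d x) /\
  (forall x, S x -> deriv_on S (deriv_on S f) x = dd x).
Proof.
  intros HS Hf Hd.
  assert (E : forall x, S x -> deriv_on S f x = d x)
    by (intros x Sx; apply deriv_on_of; auto).
  assert (H : forall x, S x -> D_in (deriv_on S f) dd S x).
  { intros x Sx; apply (D_in_congr S d _ dd); auto.
    intros; symmetry; auto. }
  split; [split|split].
  - exact (derivable_on_of S f d Hf).
  - exact (derivable_on_of S _ dd H).
  - exact E.
  - intros x Sx; apply deriv_on_of; auto.
Qed.

(** * First-order behaviour: increments, interior optima, tangents *)

(** Division-free form of the derivative, valid at [y = x] as well. *)
Lemma D_in_increment (S : R -> Prop) (f d : R -> R) (x eps : R) :
  D_in f d S x -> 0 < eps ->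
  exists a, 0 < a /\ forall y, S y -> Rabs (y - x) < a ->
    Rabs (f y - f x - d x * (y - x)) <= eps * Rabs (y - x).
Proof.
  intros Hf Heps; destruct (Hf eps Heps) as [a [Ha H]].
  exists a; split; [exact Ha|]; intros y Sy Hy.
  destruct (Req_dec y x) as [->|Hyx].
  { replace (f x - f x - d x * (x - x)) with 0 by ring.
    rewrite Rabs_R0; apply Rmult_le_pos; [lra|apply Rabs_pos]. }
  assert (H' : Rabs ((f y - f x) / (y - x) - d x) < eps)
    by (apply H; repeat split; auto).
  replace (f y - f x - d x * (y - x))
    with (((f y - f x) / (y - x) - d x) * (y - x)) by (field; lra).
  rewrite Rabs_mult; apply Rmult_le_compat_r; [apply Rabs_pos|lra].
Qed.

(** Close to [x] the increment differs from the linear term by at most half the modulus of that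
    term, so both have the same sign. *)
Lemma D_in_sign (S : R -> Prop) (f d : R -> R) (x : R) :
  D_in f d S x -> d x <> 0 ->
  exists a, 0 < a /\ forall y, S y -> y <> x -> Rabs (y - x) < a ->
    0 < (f y - f x) * (d x * (y - x)).
Proof.
  intros Hf Hd.
  assert (Hp : 0 < Rabs (d x)) by (apply Rabs_pos_lt; exact Hd).
  destruct (D_in_increment S f d x (Rabs (d x) / 2) Hf ltac:(lra)) as [a [Ha H]].
  exists a; split; [exact Ha|]; intros y Sy Hyx Hy.
  specialize (H y Sy Hy).
  replace (Rabs (d x) / 2 * Rabs (y - x)) with (Rabs (d x * (y - x)) / 2) in H
    by (rewrite Rabs_mult; field).
  assert (Hn : d x * (y - x) <> 0) by (apply Rmult_integral_contrapositive_currified; lra).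
  revert H; generalize (d x * (y - x)) Hn (f y - f x); clear.
  intros h Hh u H; unfold Rabs in H.
  destruct (Rcase_abs (u - h)), (Rcase_abs h); nra.
Qed.

(** With a nonzero slope, one of the two points [p + m] and [p - m] would beat [p]. *)
Lemma interior_argmax01_D_in (f d : R -> R) (p : R) :
  argmax01 f p -> 0 < p < 1 -> D_in f d unit_itv p -> d p = 0.
Proof.
  intros [_ Hm] Hp Hf; destruct (Req_dec (d p) 0) as [|Hd]; [assumption|exfalso].
  destruct (D_in_sign _ _ _ _ Hf Hd) as [a [Ha H]].
  set (m := Rmin (a / 2) (Rmin p (1 - p))).
  assert (Hm1 : m <= a / 2 /\ m <= p /\ m <= 1 - p).
  { unfold m; split; [apply Rmin_l|split; (eapply Rle_trans; [apply Rmin_r|])].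
    apply Rmin_l. apply Rmin_r. }
  assert (Hm0 : 0 < m) by (unfold m; repeat apply Rmin_glb_lt; lra).
  assert (U1 : unit_itv (p + m)) by (unfold unit_itv; lra).
  assert (U2 : unit_itv (p - m)) by (unfold unit_itv; lra).
  assert (K1 := H (p + m) U1 ltac:(lra)); assert (K2 := H (p - m) U2 ltac:(lra)).
  assert (L1 := Hm _ U1); assert (L2 := Hm _ U2).
  replace (p + m - p) with m in K1 by ring.
  replace (p - m - p) with (- m) in K2 by ring.
  rewrite Rabs_Ropp in K2; rewrite Rabs_pos_eq in K1, K2 by lra.
  specialize (K1 ltac:(lra)); specialize (K2 ltac:(lra)).
  rewrite Ropp_mult_distr_r_reverse in K2.
  destruct (Rdichotomy _ _ Hd); [assert (d p * m < 0) by nra|assert (0 < d p * m) by nra]; nra.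
Qed.

(** If [f y] exceeded the tangent by [g > 0], concavity would keep an excess of at least [t * g] at
    the fraction [t] of the way from [x] to [y], while differentiability allows at most [t * g / 2]
    for small [t]. *)
Lemma concave01_tangent (f d : R -> R) (x y : R) :
  concave01 f -> unit_itv x -> unit_itv y -> D_in f d unit_itv x ->
  f y <= f x + d x * (y - x).
Proof.
  intros Hc Ux Uy Hf; destruct (Req_dec y x) as [->|Hyx]; [lra|].
  apply Rnot_lt_le; intros Hlt.
  assert (Hp : 0 < Rabs (y - x)) by (apply Rabs_pos_lt; lra).
  set (g := f y - (f x + d x * (y - x))) in *.
  assert (Hg : 0 < g) by (unfold g; lra).
  destruct (D_in_increment _ _ _ _ (g / 2 / Rabs (y - x)) Hf) as [a [Ha H]].
  { apply Rdiv_lt_0_compat; lra. }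
  set (t := Rmin 1 (a / 2 / Rabs (y - x))).
  assert (Ht : 0 < t) by (apply Rmin_glb_lt; [lra|apply Rdiv_lt_0_compat; lra]).
  assert (Ht1 : t <= 1) by apply Rmin_l.
  assert (Ht2 : t * Rabs (y - x) <= a / 2).
  { apply (Rmult_le_reg_r (/ Rabs (y - x))); [apply Rinv_0_lt_compat; lra|].
    replace (t * Rabs (y - x) * / Rabs (y - x)) with t by (field; lra).
    apply Rmin_r. }
  assert (Hz : t * y + (1 - t) * x - x = t * (y - x)) by ring.
  assert (Uz : unit_itv (t * y + (1 - t) * x)) by (unfold unit_itv in *; nra).
  specialize (H _ Uz); rewrite Hz, Rabs_mult, (Rabs_pos_eq t) in H by lra.
  specialize (H ltac:(lra)).
  replace (g / 2 / Rabs (y - x) * (t * Rabs (y - x))) with (t * g / 2) in H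
    by (field; lra).
  assert (Hcc := Hc y x t Uy Ux ltac:(unfold unit_itv; lra)).
  assert (Hle := Rle_abs (f (t * y + (1 - t) * x) - f x - d x * (t * (y - x)))).
  unfold g in *; nra.
Qed.

(** * Mean value theorem, maxima and concavity on the unit interval *)

(** Composing with this retraction extends a function on the unit interval to the whole line, where
    the classical theorems on continuous functions apply. *)
Definition clamp (x : R) : R := Rmax 0 (Rmin 1 x).

Lemma unit_itv_clamp (x : R) : unit_itv (clamp x).
Proof.
  unfold unit_itv, clamp; split; [apply Rmax_l|].
  apply Rmax_lub; [lra|apply Rmin_l].
Qed.

Lemma clamp_id (x : R) : unit_itv x -> clamp x = x.
Proof. intros [H0 H1]; unfold clamp; rewrite Rmin_right, Rmax_right; lra. Qed.

Lemma clamp_lipschitz (x y : R) : Rabs (clamp y - clamp x) <= Rabs (y - x).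
Proof.
  unfold clamp, Rmax, Rmin.
  repeat destruct (Rle_dec _ _); unfold Rabs; repeat destruct (Rcase_abs _); lra.
Qed.

Lemma continuity_clamp (f : R -> R) :
  derivable_on unit_itv f -> continuity (fun x => f (clamp x)).
Proof.
  intros Hf x eps Heps.
  destruct (cont_deriv _ _ _ _ (deriv_on_spec _ _ _ Hf (unit_itv_clamp x)) eps Heps)
    as [a [Ha H]].
  exists a; split; [exact Ha|]; intros y [_ Hy]; simpl in *.
  (* Limits over [D_x] exclude the base point, so points clamped to it are treated apart. *)
  destruct (Req_dec (clamp x) (clamp y)) as [<-|Hne].
  { unfold Rdist; rewrite Rminus_diag, Rabs_R0; lra. }
  apply H; split; [split; [apply unit_itv_clamp|exact Hne]|].
  eapply Rle_lt_trans; [apply clamp_lipschitz|exact Hy].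
Qed.

Lemma derivable_pt_lim_clamp (f d : R -> R) (x : R) :
  0 < x < 1 -> D_in f d unit_itv x ->
  derivable_pt_lim (fun y => f (clamp y)) x (d x).
Proof.
  intros Hx Hf.
  apply (derivable_pt_lim_D_in _ d); intros eps Heps.
  destruct (Hf eps Heps) as [a [Ha H]].
  (* Within distance [Rmin x (1 - x)] of [x] the clamp is the identity. *)
  exists (Rmin a (Rmin x (1 - x))); split.
  { repeat apply Rmin_glb_lt; lra. }
  intros y [[_ Hy] Hd]; simpl in *.
  assert (H1 := Rmin_l a (Rmin x (1 - x))); assert (H2 := Rmin_r a (Rmin x (1 - x))).
  assert (H3 := Rmin_l x (1 - x)); assert (H4 := Rmin_r x (1 - x)).
  assert (Uy : unit_itv y).
  { assert (Hb : Rabs (y - x) < Rmin x (1 - x)) by (unfold Rdist in Hd; lra).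
    apply Rabs_def2 in Hb; unfold unit_itv; lra. }
  rewrite (clamp_id y Uy), (clamp_id x) by (unfold unit_itv; lra).
  apply H; repeat split; try assumption; try apply Uy; lra.
Qed.

(** The clamped extension is continuous everywhere and has the relative derivative as an ordinary
    one inside, so [a = 0] and [b = 1] need no special care. *)
Lemma MVT_unit_itv (f : R -> R) (a b : R) :
  derivable_on unit_itv f -> unit_itv a -> unit_itv b -> a < b ->
  exists c, a < c < b /\ f b - f a = deriv_on unit_itv f c * (b - a).
Proof.
  intros Hf Ua Ub Hab.
  set (g := fun x => f (clamp x)).
  assert (D : forall c, a < c < b -> derivable_pt_lim g c (deriv_on unit_itv f c)).
  { intros c Hc; unfold unit_itv in *; apply derivable_pt_lim_clamp; [lra|].
    apply deriv_on_spec; [assumption|unfold unit_itv; lra]. }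
  destruct (MVT g id a b (fun c Hc => exist _ _ (D c Hc))
              (fun c _ => derivable_pt_id c) Hab) as [c [Hc E]].
  - intros c _; apply continuity_clamp; assumption.
  - intros c _; apply derivable_continuous_pt, derivable_pt_id.
  - exists c; split; [exact Hc|].
    rewrite derive_pt_id in E; unfold derive_pt, id, g in E; simpl in E.
    rewrite (clamp_id a), (clamp_id b) in E by assumption; lra.
Qed.

Lemma argmax01_exists (f : R -> R) :
  derivable_on unit_itv f -> exists p, argmax01 f p.
Proof.
  intros Hf.
  destruct (continuity_ab_maj (fun x => f (clamp x)) 0 1 ltac:(lra)) as [p [Hp Up]].
  { intros c _; apply continuity_clamp; assumption. }
  exists p; split; [exact Up|]; intros q Uq.
  specialize (Hp q Uq); simpl in Hp; rewrite !clamp_id in Hp; assumption.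
Qed.

(** The derivative is nonincreasing, so the mean slope on the left of an intermediate point is at
    least the mean slope on its right. *)
Lemma concave01_of_deriv2 (f : R -> R) :
  twice_derivable_on unit_itv f ->
  (forall p, unit_itv p -> deriv_on unit_itv (deriv_on unit_itv f) p <= 0) ->
  concave01 f.
Proof.
  intros [Hf Hf'] Hneg.
  assert (Hmono : forall a b, unit_itv a -> unit_itv b -> a < b ->
    deriv_on unit_itv f b <= deriv_on unit_itv f a).
  { intros a b Ua Ub Hab.
    destruct (MVT_unit_itv _ _ _ Hf' Ua Ub Hab) as [c [Hc E]].
    assert (Hn := Hneg c ltac:(unfold unit_itv in *; lra)); nra. }
  assert (Hlt : forall x y t, unit_itv x -> unit_itv y -> unit_itv t -> x < y ->
    t * f x + (1 - t) * f y <= f (t * x + (1 - t) * y)).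
  { intros x y t Ux Uy Ut Hxy.
    destruct (Req_dec t 0) as [->|Ht0].
    { replace (0 * x + (1 - 0) * y) with y by ring; lra. }
    destruct (Req_dec t 1) as [->|Ht1].
    { replace (1 * x + (1 - 1) * y) with x by ring; lra. }
    set (z := t * x + (1 - t) * y).
    assert (Hz1 : z - x = (1 - t) * (y - x)) by (unfold z; ring).
    assert (Hz2 : y - z = t * (y - x)) by (unfold z; ring).
    unfold unit_itv in *.
    assert (x < z) by nra. assert (z < y) by nra.
    destruct (MVT_unit_itv f x z Hf) as [a [Ha Ea]]; unfold unit_itv; try lra.
    destruct (MVT_unit_itv f z y Hf) as [b [Hb Eb]]; unfold unit_itv; try lra.
    assert (Hd : deriv_on unit_itv f b <= deriv_on unit_itv f a)
      by (apply Hmono; unfold unit_itv; lra).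
    rewrite Hz1 in Ea; rewrite Hz2 in Eb; fold unit_itv in *.
    assert (Ht : 0 < t * (1 - t) * (y - x)) by (repeat apply Rmult_lt_0_compat; lra).
    assert (t * (f z - f x) - (1 - t) * (f y - f z) =
      t * (1 - t) * (y - x) * (deriv_on unit_itv f a - deriv_on unit_itv f b))
      by (rewrite Ea, Eb; ring).
    nra. }
  intros x y t Ux Uy Ut.
  destruct (Rtotal_order x y) as [Hxy|[<-|Hxy]].
  - auto.
  - replace (t * x + (1 - t) * x) with x by ring; lra.
  - assert (H := Hlt y x (1 - t) Uy Ux ltac:(unfold unit_itv in *; lra) Hxy).
    replace (1 - (1 - t)) with t in H by ring.
    rewrite (Rplus_comm (t * x)); lra.
Qed.

(** * Calculus rules for relative derivatives *)

(** [Dcomp] differentiates over the points of [S] that [f] sends into [S']; here these are all of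
    [S]. *)
Lemma D_in_comp_into (S S' : R -> Prop) (f g df dg : R -> R) (x : R) :
  S x -> (forall y, S y -> S' (f y)) -> D_in f df S x -> D_in g dg S' (f x) ->
  D_in (fun y => g (f y)) (fun y => df y * dg (f y)) S x.
Proof.
  intros Sx HS Hf Hg eps Heps.
  destruct (Dcomp _ _ _ _ _ _ _ Hf Hg eps Heps) as [a [Ha H]].
  exists a; split; [exact Ha|]; intros y [[Sy Hy] Hyx].
  apply H; repeat split; auto.
Qed.

Lemma derivable_on_comp (S S' : R -> Prop) (f g : R -> R) :
  (forall y, S y -> S' (f y)) -> derivable_on S f -> derivable_on S' g ->
  derivable_on S (fun y => g (f y)).
Proof.
  intros HS Hf Hg x Sx; eexists.
  exact (D_in_comp_into S S' f g _ _ x Sx HS (deriv_on_spec S f x Hf Sx)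
           (deriv_on_spec S' g (f x) Hg (HS x Sx))).
Qed.

Lemma derivable_on_plus (S : R -> Prop) (f g : R -> R) :
  derivable_on S f -> derivable_on S g -> derivable_on S (fun x => f x + g x).
Proof.
  intros Hf Hg x Sx; eexists.
  exact (Dadd _ _ _ _ _ _ (deriv_on_spec _ _ _ Hf Sx) (deriv_on_spec _ _ _ Hg Sx)).
Qed.

Lemma derivable_on_minus (S : R -> Prop) (f g : R -> R) :
  derivable_on S f -> derivable_on S g -> derivable_on S (fun x => f x - g x).
Proof.
  intros Hf Hg x Sx; eexists.
  exact (Dminus _ _ _ _ _ _ (deriv_on_spec _ _ _ Hf Sx) (deriv_on_spec _ _ _ Hg Sx)).
Qed.

Lemma derivable_on_mult (S : R -> Prop) (f g : R -> R) :
  derivable_on S f -> derivable_on S g -> derivable_on S (fun x => f x * g x).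
Proof.
  intros Hf Hg x Sx; eexists.
  exact (Dmult _ _ _ _ _ _ (deriv_on_spec _ _ _ Hf Sx) (deriv_on_spec _ _ _ Hg Sx)).
Qed.

Lemma derivable_on_const (S : R -> Prop) (a : R) : derivable_on S (fun _ => a).
Proof. intros x _; exists 0; apply Dconst. Qed.

Lemma derivable_on_congr (S : R -> Prop) (f g : R -> R) :
  (forall y, S y -> f y = g y) -> derivable_on S f -> derivable_on S g.
Proof.
  intros Hfg Hf x Sx; exists (deriv_on S f x).
  apply (D_in_congr S f g (deriv_on S f)); auto; apply deriv_on_spec; assumption.
Qed.

Lemma deriv_on_plus (S : R -> Prop) (f g : R -> R) (x : R) :
  dense_in_itself S -> derivable_on S f -> derivable_on S g -> S x ->
  deriv_on S (fun y => f y + g y) x = deriv_on S f x + deriv_on S g x.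
Proof.
  intros HS Hf Hg Sx; apply deriv_on_eq; [assumption..|].
  exact (Dadd _ _ _ _ _ _ (deriv_on_spec _ _ _ Hf Sx) (deriv_on_spec _ _ _ Hg Sx)).
Qed.

Lemma deriv_on_congr (S : R -> Prop) (f g : R -> R) (x : R) :
  dense_in_itself S -> (forall y, S y -> f y = g y) -> derivable_on S f -> S x ->
  deriv_on S g x = deriv_on S f x.
Proof.
  intros HS Hfg Hf Sx; apply deriv_on_eq; [assumption..|].
  apply (D_in_congr S f g (deriv_on S f)); auto; apply deriv_on_spec; assumption.
Qed.

(** * Differentiability of the objectives and the wedge *)

(** Places investment in the domain where [Fdev] and [Gagg] are regular: [rret] increases from a
    nonnegative value at 0. *)
Lemma investment_nneg (E : economy) (p : R) :
  standing E -> unit_itv p -> nneg (investment E p).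
Proof.
  intros HE Up.
  assert (Hr : 0 <= rret E p).
  { destruct (Req_dec p 0) as [->|Hp]; [apply r_zero, HE|].
    destruct (MVT_unit_itv (rret E) 0 p) as [c [Hc Ec]];
      [apply r_reg, HE|unfold unit_itv in *; lra..|].
    assert (H0 := r_zero _ HE).
    assert (H1 := r_incr _ HE c ltac:(unfold unit_itv in *; lra)); nra. }
  apply Rle_mult_inv_pos; [exact Hr|apply c_pos, HE].
Qed.

Lemma derivable_on_investment (E : economy) :
  standing E -> derivable_on unit_itv (investment E).
Proof.
  intros HE; apply derivable_on_mult; [apply r_reg, HE|apply derivable_on_const].
Qed.

Lemma derivable_on_profit (E : economy) (v : R) :
  standing E -> derivable_on unit_itv (profit E v).
Proof.
  intros HE; assert (He := derivable_on_investment E HE).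
  unfold profit; cbv zeta.
  repeat first [exact He | apply derivable_on_minus | apply derivable_on_plus
               | apply derivable_on_mult | apply derivable_on_const].
  - apply (derivable_on_comp _ nneg); [|exact He|apply F_reg, HE].
    intros; apply investment_nneg; assumption.
  - apply (derivable_on_comp _ nneg (fun p => INR (Ndev E) * investment E p)).
    + intros; apply Rmult_le_pos; [apply pos_INR|apply investment_nneg; assumption].
    + apply derivable_on_mult; [apply derivable_on_const|exact He].
    + apply G_reg, HE.
  - apply r_reg, HE.
  - apply C_reg, HE.
  - apply T_reg, HE.
  - apply H_reg, HE.
Qed.

(** As [r = c * e], the difference [N * r * e - N * c / 2 * e ^ 2] collapses to [N * c / 2 * e ^ 2];
    the verification level [v] cancels. *)
Definition wedge_integral (E : economy) (p : R) : R :=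
  INR (Ndev E) * cinv E / 2 * (investment E p * investment E p)
  + (1 - omega E) * Tleak E p - Ddup E p.

Lemma welfare_profit (E : economy) (v p : R) :
  0 < cinv E -> welfare E v p = profit E v p + wedge_integral E p.
Proof.
  intros Hc; unfold welfare, profit, wedge_integral, investment; cbv zeta; field; lra.
Qed.

(** The square of investment contributes [N * c * e * e'], and [c * e' = r'] turns it into
    [N * r' * e]. *)
Lemma D_in_wedge_integral (E : economy) (p : R) :
  standing E -> unit_itv p ->
  D_in (wedge_integral E)
    (fun p => INR (Ndev E) * deriv_on unit_itv (rret E) p * investment E p
              + (1 - omega E) * deriv_on unit_itv (Tleak E) p
              - deriv_on unit_itv (Ddup E) p) unit_itv p.
Proof.
  intros HE Up; assert (Hc := c_pos _ HE).
  assert (Hr := deriv_on_spec _ _ _ (proj1 (r_reg _ HE)) Up).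
  assert (He : D_in (investment E) (fun p => deriv_on unit_itv (rret E) p / cinv E)
                 unit_itv p).
  { apply (D_in_congr _ (fun p => / cinv E * rret E p) _
             (fun p => / cinv E * deriv_on unit_itv (rret E) p)); auto.
    - intros; unfold investment; field; lra.
    - field; lra.
    - apply Dmult_const; exact Hr. }
  assert (H := Dminus _ _ _ _ _ _
    (Dadd _ _ _ _ _ _
      (Dmult_const _ _ _ _ (INR (Ndev E) * cinv E / 2) (Dmult _ _ _ _ _ _ He He))
      (Dmult_const _ _ _ _ (1 - omega E) (deriv_on_spec _ _ _ (T_reg _ HE) Up)))
    (deriv_on_spec _ _ _ (D_reg _ HE) Up)).
  revert H; apply D_in_congr; auto.
  cbv beta; field; lra.
Qed.

Lemma derivable_on_wedge_integral (E : economy) :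
  standing E -> derivable_on unit_itv (wedge_integral E).
Proof.
  intros HE; eapply derivable_on_of; intros p Up; apply D_in_wedge_integral; assumption.
Qed.

Lemma derivable_on_welfare (E : economy) (v : R) :
  standing E -> derivable_on unit_itv (welfare E v).
Proof.
  intros HE; apply (derivable_on_congr _ (fun p => profit E v p + wedge_integral E p)).
  - intros; symmetry; apply welfare_profit, c_pos, HE.
  - apply derivable_on_plus; [apply derivable_on_profit|apply derivable_on_wedge_integral];
      exact HE.
Qed.

Lemma wedge_deriv (E : economy) (v p : R) :
  standing E -> unit_itv p -> wedge E v p = deriv_on unit_itv (wedge_integral E) p.
Proof.
  intros HE Up; assert (HP := derivable_on_profit E v HE).
  assert (HI := derivable_on_wedge_integral E HE).
  unfold wedge.
  rewrite (deriv_on_congr _ (fun p => profit E v p + wedge_integral E p)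
             (welfare E v) p unit_itv_dense_in_itself);
    [|intros; symmetry; apply welfare_profit, c_pos, HE
     |apply derivable_on_plus; assumption|exact Up].
  rewrite (deriv_on_plus _ _ _ _ unit_itv_dense_in_itself HP HI Up); ring.
Qed.

Lemma wedge_formula (E : economy) (v p : R) :
  standing E -> unit_itv p ->
  wedge E v p =
    INR (Ndev E) * deriv_on unit_itv (rret E) p * investment E p
    + (1 - omega E) * deriv_on unit_itv (Tleak E) p - deriv_on unit_itv (Ddup E) p.
Proof.
  intros HE Up; rewrite (wedge_deriv E v p HE Up).
  apply (deriv_on_of _ _ _ _ unit_itv_dense_in_itself Up (D_in_wedge_integral E p HE Up)).
Qed.

(** Applying the mean value theorem to the difference of the objectives gives a single intermediate
    point, at which the wedge itself appears. *)
Lemma welfare_profit_MVT (E : economy) (v a b : R) :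
  standing E -> unit_itv a -> unit_itv b -> a < b ->
  exists q, a < q < b /\
    welfare E v b - welfare E v a
    = profit E v b - profit E v a + wedge E v q * (b - a).
Proof.
  intros HE Ua Ub Hab; assert (Hc := c_pos _ HE).
  destruct (MVT_unit_itv (wedge_integral E) a b (derivable_on_wedge_integral E HE) Ua Ub Hab)
    as [q [Hq Eq]].
  exists q; split; [exact Hq|].
  rewrite (wedge_deriv E v q HE) by (unfold unit_itv in *; lra).
  rewrite !welfare_profit by exact Hc; lra.
Qed.

(** * Comparison of private and social optima *)

Lemma strictly_concave01_concave01 (f : R -> R) : strictly_concave01 f -> concave01 f.
Proof.
  intros H x y t Ux Uy Ut; destruct (Req_dec x y) as [<-|Hxy].
  { replace (t * x + (1 - t) * x) with x by ring; lra. }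
  destruct (Req_dec t 0) as [->|Ht0].
  { replace (0 * x + (1 - 0) * y) with y by ring; lra. }
  destruct (Req_dec t 1) as [->|Ht1].
  { replace (1 * x + (1 - 1) * y) with x by ring; lra. }
  left; apply H; auto; unfold unit_itv in *; lra.
Qed.

(** If [f q = f p], the midpoint would beat the maximum. *)
Lemma strictly_concave01_argmax01_lt (f : R -> R) (p q : R) :
  strictly_concave01 f -> argmax01 f p -> unit_itv q -> q <> p -> f q < f p.
Proof.
  intros Hf [Up Hp] Uq Hqp.
  assert (H := Hf q p (1 / 2) Uq Up Hqp ltac:(lra)).
  specialize (Hp (1 / 2 * q + (1 - 1 / 2) * p) ltac:(unfold unit_itv in *; lra)).
  lra.
Qed.

(** The tangent inequality makes the first-order condition sufficient, also at an end point; strict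
    concavity gives uniqueness. *)
Lemma private_level_unique_of_deriv0 (E : economy) (v p q : R) :
  standing E -> unit_itv v -> unit_itv p -> deriv_on unit_itv (profit E v) p = 0 ->
  private_level E v p /\ (private_level E v q -> q = p).
Proof.
  intros HE Uv Up H0; assert (HS := profit_sconc _ HE v Uv).
  assert (Hp : private_level E v p).
  { split; [exact Up|]; intros y Uy.
    assert (H := concave01_tangent _ _ p y (strictly_concave01_concave01 _ HS) Up Uy
                   (deriv_on_spec _ _ _ (derivable_on_profit E v HE) Up)).
    rewrite H0 in H; lra. }
  split; [exact Hp|]; intros [Uq Hq].
  destruct (Req_dec q p) as [|Hne]; [assumption|exfalso].
  assert (H := strictly_concave01_argmax01_lt _ _ _ HS Hp Uq Hne).
  specialize (Hq p Up); lra.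
Qed.

Lemma levels_exist_standing (E : economy) (v : R) : standing E -> levels_exist E v.
Proof.
  intros HE; split; apply argmax01_exists;
    [apply derivable_on_profit|apply derivable_on_welfare]; exact HE.
Qed.

(** At the private optimum [p] the slope of welfare is the wedge. The tangent bound gives welfare at
    most its value at [p] to the left of [p], while a small step to the right, possible as [p < 1],
    does strictly better. *)
Lemma strictly_too_closed_of_wedge (E : economy) (v p : R) :
  standing E -> unit_itv v -> objectives_concave E v -> 0 <= p < 1 ->
  deriv_on unit_itv (profit E v) p = 0 -> 0 < wedge E v p ->
  strictly_too_closed E v.
Proof.
  intros HE Uv [_ HW] Hp H0 Hw; assert (Up : unit_itv p) by (unfold unit_itv; lra).
  split; [apply levels_exist_standing, HE|].
  intros pP pS HP [US HS].
  rewrite (proj2 (private_level_unique_of_deriv0 E v p pP HE Uv Up H0) HP).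
  assert (HD := deriv_on_spec _ _ _ (derivable_on_welfare E v HE) Up).
  unfold wedge in Hw; rewrite H0 in Hw.
  destruct (D_in_sign _ _ _ _ HD ltac:(lra)) as [a [Ha H]].
  assert (HT := concave01_tangent _ _ p pS HW Up US HD).
  apply Rnot_le_lt; intros Hle.
  set (m := Rmin (a / 2) (1 - p)).
  assert (m <= a / 2) by apply Rmin_l. assert (m <= 1 - p) by apply Rmin_r.
  assert (0 < m) by (apply Rmin_glb_lt; lra).
  assert (Um : unit_itv (p + m)) by (unfold unit_itv; lra).
  specialize (H (p + m) Um ltac:(lra)).
  replace (p + m - p) with m in H by ring.
  rewrite Rabs_pos_eq in H by lra; specialize (H ltac:(lra)).
  assert (HM := HS _ Um).
  assert (Hl : 0 < deriv_on unit_itv (welfare E v) p * m) by (apply Rmult_lt_0_compat; lra).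
  rewrite <- (Rmult_0_l (deriv_on unit_itv (welfare E v) p * m)) in H.
  apply Rmult_lt_reg_r in H; [|exact Hl].
  assert (deriv_on unit_itv (welfare E v) p * (pS - p) <= 0) by nra.
  lra.
Qed.

(** Mirror image: the improving step goes to the left, which is why [p = 0] is excluded and [p = 1]
    allowed. *)
Lemma strictly_too_open_of_wedge (E : economy) (v p : R) :
  standing E -> unit_itv v -> objectives_concave E v -> 0 < p <= 1 ->
  deriv_on unit_itv (profit E v) p = 0 -> wedge E v p < 0 ->
  strictly_too_open E v.
Proof.
  intros HE Uv [_ HW] Hp H0 Hw; assert (Up : unit_itv p) by (unfold unit_itv; lra).
  split; [apply levels_exist_standing, HE|].
  intros pP pS HP [US HS].
  rewrite (proj2 (private_level_unique_of_deriv0 E v p pP HE Uv Up H0) HP).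
  assert (HD := deriv_on_spec _ _ _ (derivable_on_welfare E v HE) Up).
  unfold wedge in Hw; rewrite H0 in Hw.
  destruct (D_in_sign _ _ _ _ HD ltac:(lra)) as [a [Ha H]].
  assert (HT := concave01_tangent _ _ p pS HW Up US HD).
  apply Rnot_le_lt; intros Hle.
  set (m := Rmin (a / 2) p).
  assert (m <= a / 2) by apply Rmin_l. assert (m <= p) by apply Rmin_r.
  assert (0 < m) by (apply Rmin_glb_lt; lra).
  assert (Um : unit_itv (p - m)) by (unfold unit_itv; lra).
  specialize (H (p - m) Um ltac:(lra)).
  replace (p - m - p) with (- m) in H by ring.
  rewrite Rabs_Ropp, Rabs_pos_eq in H by lra; specialize (H ltac:(lra)).
  assert (HM := HS _ Um).
  assert (Hl : 0 < deriv_on unit_itv (welfare E v) p * - m) by nra.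
  rewrite <- (Rmult_0_l (deriv_on unit_itv (welfare E v) p * - m)) in H.
  apply Rmult_lt_reg_r in H; [|exact Hl].
  assert (deriv_on unit_itv (welfare E v) p * (pS - p) <= 0) by nra.
  lra.
Qed.

(** If [pS < pP], moving from [pS] to [pP] strictly raises profit and the wedge term does not lower
    welfare, so [pS] would not be a social optimum. *)
Lemma private_le_social (E : economy) (v pP pS : R) :
  standing E -> unit_itv v -> (forall p, 0 <= p < 1 -> 0 <= wedge E v p) ->
  private_level E v pP -> social_level E v pS -> pP <= pS.
Proof.
  intros HE Uv Hw HP [US HS]; apply Rnot_lt_le; intros Hlt.
  assert (UP := proj1 HP).
  destruct (welfare_profit_MVT E v pS pP HE US UP Hlt) as [q [Hq Eq]].
  specialize (HS pP UP).
  assert (H := strictly_concave01_argmax01_lt _ _ pS (profit_sconc _ HE v Uv) HP US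
                 ltac:(lra)).
  specialize (Hw q ltac:(unfold unit_itv in *; lra)); nra.
Qed.

Lemma social_le_private (E : economy) (v pP pS : R) :
  standing E -> unit_itv v -> (forall p, 0 <= p < 1 -> wedge E v p <= 0) ->
  private_level E v pP -> social_level E v pS -> pS <= pP.
Proof.
  intros HE Uv Hw HP [US HS]; apply Rnot_lt_le; intros Hlt.
  assert (UP := proj1 HP).
  destruct (welfare_profit_MVT E v pP pS HE UP US Hlt) as [q [Hq Eq]].
  specialize (HS pP UP).
  assert (H := strictly_concave01_argmax01_lt _ _ pS (profit_sconc _ HE v Uv) HP US
                 ltac:(lra)).
  specialize (Hw q ltac:(unfold unit_itv in *; lra)); nra.
Qed.

(** Under a strict wedge this excludes a common interior optimum and so upgrades the weak
    orderings. *)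
Lemma wedge_zero_of_common_level (E : economy) (v p : R) :
  standing E -> private_level E v p -> social_level E v p -> 0 < p < 1 ->
  wedge E v p = 0.
Proof.
  intros HE HP HS Hp; unfold wedge.
  rewrite (interior_argmax01_D_in _ _ _ HP Hp
    (deriv_on_spec _ _ _ (derivable_on_profit E v HE) (proj1 HP))).
  rewrite (interior_argmax01_D_in _ _ _ HS Hp
    (deriv_on_spec _ _ _ (derivable_on_welfare E v HE) (proj1 HS))).
  ring.
Qed.

(** The wedge may be discontinuous, so the sign at 0 does not spread by continuity. Instead
    [wedge_integral] drops just right of 0, and the mean value theorem turns the drop into an
    interior point of negative wedge. *)
Lemma wedge_neg_interior (E : economy) (v : R) :
  standing E -> (exists p, 0 <= p < 1 /\ wedge E v p < 0) ->
  exists p, 0 < p < 1 /\ wedge E v p < 0.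
Proof.
  intros HE [p [Hp Hw]].
  destruct (Req_dec p 0) as [->|Hp0]; [|exists p; lra].
  assert (U0 : unit_itv 0) by (unfold unit_itv; lra).
  rewrite (wedge_deriv E v 0 HE U0) in Hw.
  assert (HI := derivable_on_wedge_integral E HE).
  destruct (D_in_sign _ _ _ _ (deriv_on_spec _ _ _ HI U0) ltac:(lra)) as [a [Ha H]].
  set (m := Rmin (a / 2) 1).
  assert (m <= a / 2) by apply Rmin_l. assert (m <= 1) by apply Rmin_r.
  assert (0 < m) by (apply Rmin_glb_lt; lra).
  assert (Um : unit_itv m) by (unfold unit_itv; lra).
  specialize (H m Um ltac:(lra)); rewrite Rminus_0_r, Rabs_pos_eq in H by lra.
  specialize (H ltac:(lra)).
  destruct (MVT_unit_itv _ 0 m HI U0 Um ltac:(lra)) as [q [Hq Eq]].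
  exists q; split; [lra|].
  rewrite (wedge_deriv E v q HE) by (unfold unit_itv; lra).
  rewrite Eq, Rminus_0_r in H.
  assert (deriv_on unit_itv (wedge_integral E) 0 * m < 0) by nra.
  assert (deriv_on unit_itv (wedge_integral E) q * m < 0) by nra.
  nra.
Qed.

(** * Tilting an economy without changing its wedge *)

Definition tilt (A B : R) (E : economy) : economy :=
  Economy (Ndev E) (cinv E) (omega E) (fun x => Fdev E x + A * x) (Gagg E) (rret E)
    (fun p => Cconv E p + B * p) (Tleak E) (Hharm E) (Ddup E) (kver E).

(** The common increment of profit and welfare: [N * A * e - B * p] with [e = r / c]. *)
Definition tilt_term (A B : R) (E : economy) (p : R) : R :=
  INR (Ndev E) * A / cinv E * rret E p - B * p.

Lemma profit_tilt (A B : R) (E : economy) (v p : R) :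
  0 < cinv E -> profit (tilt A B E) v p = profit E v p + tilt_term A B E p.
Proof.
  intros Hc; unfold profit, tilt_term, investment, tilt; simpl; field; lra.
Qed.

Lemma welfare_tilt (A B : R) (E : economy) (v p : R) :
  0 < cinv E -> welfare (tilt A B E) v p = welfare E v p + tilt_term A B E p.
Proof.
  intros Hc; unfold welfare, tilt_term, investment, tilt; simpl; field; lra.
Qed.

Lemma D_in_tilt_term (A B : R) (E : economy) (p : R) :
  standing E -> unit_itv p ->
  D_in (tilt_term A B E)
    (fun p => INR (Ndev E) * A / cinv E * deriv_on unit_itv (rret E) p - B * 1)
    unit_itv p.
Proof.
  intros HE Up.
  assert (Hr := deriv_on_spec _ _ _ (proj1 (r_reg _ HE)) Up).
  exact (Dminus _ _ _ _ _ _ (Dmult_const _ _ _ _ _ Hr) (Dmult_const _ _ _ _ _ (Dx _ _))).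
Qed.

(** A nonnegative multiple of the concave [rret] plus a linear term. *)
Lemma concave01_tilt_term (A B : R) (E : economy) :
  0 <= A -> standing E -> concave01 (tilt_term A B E).
Proof.
  intros HA HE x y t Ux Uy Ut.
  assert (Hr := concave01_of_deriv2 _ (r_reg _ HE) (r_conc _ HE) x y t Ux Uy Ut).
  assert (HK : 0 <= INR (Ndev E) * A / cinv E).
  { apply Rle_mult_inv_pos; [apply Rmult_le_pos; [apply pos_INR|exact HA]|apply c_pos, HE]. }
  unfold tilt_term; nra.
Qed.

(** The signs of [A] and [B] preserve [F' > 0] and [C' >= 0], the second derivative of [F] is
    unchanged, and profit gains a concave term. *)
Lemma standing_tilt (A B : R) (E : economy) :
  0 <= A -> 0 <= B -> standing E -> standing (tilt A B E).
Proof.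
  intros HA HB HE.
  assert (TF : twice_derivable_on nneg (fun x => Fdev E x + A * x) /\
    (forall x, nneg x -> deriv_on nneg (fun x => Fdev E x + A * x) x
                         = deriv_on nneg (Fdev E) x + A * 1) /\
    (forall x, nneg x -> deriv_on nneg (deriv_on nneg (fun x => Fdev E x + A * x)) x
                         = deriv_on nneg (deriv_on nneg (Fdev E)) x + 0)).
  { apply (twice_derivable_on_of nneg _
      (fun x => deriv_on nneg (Fdev E) x + A * 1)
      (fun x => deriv_on nneg (deriv_on nneg (Fdev E)) x + 0) nneg_dense_in_itself).
    - intros x Sx.
      exact (Dadd _ _ _ _ _ _ (deriv_on_spec _ _ _ (proj1 (F_reg _ HE)) Sx)
               (Dmult_const _ _ _ _ _ (Dx _ _))).
    - intros x Sx.
      exact (Dadd _ _ _ _ _ _ (deriv_on_spec _ _ _ (proj2 (F_reg _ HE)) Sx)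
               (Dconst _ _ _)). }
  destruct TF as [TF1 [TF2 TF3]].
  assert (TC : forall p, unit_itv p ->
    D_in (fun p => Cconv E p + B * p) (fun p => deriv_on unit_itv (Cconv E) p + B * 1)
      unit_itv p).
  { intros p Up.
    exact (Dadd _ _ _ _ _ _ (deriv_on_spec _ _ _ (C_reg _ HE) Up)
             (Dmult_const _ _ _ _ _ (Dx _ _))). }
  constructor; simpl; try apply HE; [exact TF1|..].
  - intros x Sx; rewrite TF2 by assumption; assert (H := F_incr _ HE x Sx); lra.
  - intros x Sx; rewrite TF3 by assumption; assert (H := F_conc _ HE x Sx); lra.
  - exact (derivable_on_of _ _ _ TC).
  - intros p Up.
    rewrite (deriv_on_of _ _ _ _ unit_itv_dense_in_itself Up (TC p Up)).
    assert (H := C_incr _ HE p Up); lra.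
  - intros v Uv x y t Ux Uy Hxy Ht; rewrite !profit_tilt by apply c_pos, HE.
    assert (H1 := profit_sconc _ HE v Uv x y t Ux Uy Hxy Ht).
    assert (H2 := concave01_tilt_term A B E HA HE x y t Ux Uy ltac:(unfold unit_itv; lra)).
    lra.
Qed.

Lemma objectives_concave_tilt (A B : R) (E : economy) (v : R) :
  0 <= A -> standing E -> objectives_concave E v -> objectives_concave (tilt A B E) v.
Proof.
  intros HA HE [HP HW]; split; intros x y t Ux Uy Ut;
    rewrite ?profit_tilt, ?welfare_tilt by apply c_pos, HE;
    assert (H := concave01_tilt_term A B E HA HE x y t Ux Uy Ut).
  - specialize (HP x y t Ux Uy Ut); lra.
  - specialize (HW x y t Ux Uy Ut); lra.
Qed.

Lemma exists_tilt_deriv0 (E : economy) (v p : R) :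
  standing E -> unit_itv p ->
  exists A B, 0 <= A /\ 0 <= B /\ deriv_on unit_itv (profit (tilt A B E) v) p = 0.
Proof.
  intros HE Up.
  set (d := deriv_on unit_itv (profit E v) p).
  set (s := deriv_on unit_itv (rret E) p).
  assert (Hs : 0 < s) by apply (r_incr _ HE p Up).
  assert (Hc := c_pos _ HE).
  assert (HN : 0 < INR (Ndev E)) by (apply lt_0_INR; assert (H := N_ge2 _ HE); lia).
  assert (HK : 0 < cinv E / (INR (Ndev E) * s))
    by (apply Rdiv_lt_0_compat; [|apply Rmult_lt_0_compat]; assumption).
  (* The tilt adds [N * A * s / c - B] to the slope [d]. This [A] makes the first term [Rabs d], and
     [B = Rabs d + d] cancels the rest; both are nonnegative whatever the sign of [d]. *)
  exists (cinv E / (INR (Ndev E) * s) * Rabs d), (Rabs d + d).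
  split; [apply Rmult_le_pos; [lra|apply Rabs_pos]|].
  split; [assert (H := Rle_abs (- d)); rewrite Rabs_Ropp in H; lra|].
  assert (HP := derivable_on_profit E v HE).
  apply (deriv_on_eq _ _ _ _ unit_itv_dense_in_itself Up).
  refine (D_in_congr _ _ _ _ _ _ Up _ _
    (Dadd _ _ _ _ _ _ (deriv_on_spec _ _ _ HP Up) (D_in_tilt_term _ _ E p HE Up))).
  - intros; symmetry; apply profit_tilt, Hc.
  - cbv beta; fold d s; field; lra.
Qed.

Lemma same_wedge_primitives_tilt (A B : R) (E : economy) :
  same_wedge_primitives E (tilt A B E).
Proof. repeat split. Qed.

(** The closed form of the wedge mentions only primitives that [tilt] leaves alone. *)
Lemma wedge_tilt (A B : R) (E : economy) (v p : R) :
  0 <= A -> 0 <= B -> standing E -> unit_itv p -> wedge (tilt A B E) v p = wedge E v p.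
Proof.
  intros HA HB HE Up.
  rewrite !wedge_formula by auto using standing_tilt; reflexivity.
Qed.

Lemma tilt_both_orderings (E : economy) (v : R) :
  standing E -> unit_itv v -> objectives_concave E v -> wedge_changes_sign E v ->
  (exists E1, standing E1 /\ objectives_concave E1 v /\
     same_wedge_primitives E E1 /\ strictly_too_closed E1 v) /\
  (exists E2, standing E2 /\ objectives_concave E2 v /\
     same_wedge_primitives E E2 /\ strictly_too_open E2 v).
Proof.
  intros HE Uv HO [[p [Hp Hw]] Hneg]; split.
  - assert (Up : unit_itv p) by (unfold unit_itv; lra).
    destruct (exists_tilt_deriv0 E v p HE Up) as [A [B [HA [HB H0]]]].
    assert (HE' := standing_tilt A B E HA HB HE).
    assert (HO' := objectives_concave_tilt A B E v HA HE HO).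
    exists (tilt A B E); split; [exact HE'|split; [exact HO'|]].
    split; [apply same_wedge_primitives_tilt|].
    apply (strictly_too_closed_of_wedge _ v p); auto.
    rewrite wedge_tilt; assumption.
  - destruct (wedge_neg_interior E v HE Hneg) as [q [Hq Hwq]].
    assert (Uq : unit_itv q) by (unfold unit_itv; lra).
    destruct (exists_tilt_deriv0 E v q HE Uq) as [A [B [HA [HB H0]]]].
    assert (HE' := standing_tilt A B E HA HB HE).
    assert (HO' := objectives_concave_tilt A B E v HA HE HO).
    exists (tilt A B E); split; [exact HE'|split; [exact HO'|]].
    split; [apply same_wedge_primitives_tilt|].
    apply (strictly_too_open_of_wedge _ v q); auto; [lra|].
    rewrite wedge_tilt; assumption.
Qed.

(* Profit peaks at [p = (1 + 2 v) / 4], which crosses the zero [p = 1/2] of the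
   wedge [1 - 2 p] as [v] goes from 0 to 1. *)
Definition flip_economy (N : nat) (c w : R) : economy :=
  Economy N c w (fun x => 3 / 4 * x) (fun x => 3 / 4 * x) (fun p => p)
    (fun _ => 0) (fun _ => 0) (fun p => INR N / c * p)
    (fun p => (INR N / (2 * c) + 1) * p ^ 2 - p) (fun v => v ^ 2 + v).

(** * Quadratic functions and the flipping example *)

Lemma D_in_of_derivable_pt_lim (S : R -> Prop) (f d : R -> R) (x : R) :
  derivable_pt_lim f x (d x) -> D_in f d S x.
Proof.
  intros H eps Heps; apply derivable_pt_lim_D_in in H.
  destruct (H eps Heps) as [a [Ha K]]; exists a; split; [exact Ha|].
  intros y [[_ Hy] Hyx]; apply K; repeat split; assumption.
Qed.

Lemma D_in_quadratic (S : R -> Prop) (a b k x : R) :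
  D_in (fun y => a * y ^ 2 + b * y + k) (fun y => 2 * a * y + b) S x.
Proof.
  apply D_in_of_derivable_pt_lim.
  replace (2 * a * x + b) with (a * (INR 2 * x ^ pred 2) + b * 1 + 0) by (simpl; ring).
  apply derivable_pt_lim_plus; [apply derivable_pt_lim_plus|apply derivable_pt_lim_const].
  - apply (derivable_pt_lim_scal (fun y => y ^ 2)), derivable_pt_lim_pow.
  - apply (derivable_pt_lim_scal id), derivable_pt_lim_id.
Qed.

Lemma quadratic_deriv_on (S : R -> Prop) (f : R -> R) (a b k : R) :
  dense_in_itself S -> (forall x, f x = a * x ^ 2 + b * x + k) ->
  twice_derivable_on S f /\
  (forall x, S x -> deriv_on S f x = 2 * a * x + b) /\
  (forall x, S x -> deriv_on S (deriv_on S f) x = 2 * a).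
Proof.
  intros HS Hf.
  apply (twice_derivable_on_of S f (fun x => 2 * a * x + b) (fun _ => 2 * a) HS).
  - intros x Sx; refine (D_in_congr _ _ _ _ _ _ Sx _ eq_refl (D_in_quadratic S a b k x)).
    intros; symmetry; apply Hf.
  - intros x Sx; refine (D_in_congr _ _ _ _ _ _ Sx _ _ (D_in_quadratic S 0 (2 * a) b x));
      intros; ring.
Qed.

(** The concavity gap is exactly [- a * (t * (1 - t)) * (x - y) ^ 2]. *)
Lemma quadratic_strictly_concave01 (f : R -> R) (a b k : R) :
  (forall x, f x = a * x ^ 2 + b * x + k) -> a < 0 -> strictly_concave01 f.
Proof.
  intros Hf Ha x y t _ _ Hxy Ht; rewrite !Hf.
  assert (H : a * (t * x + (1 - t) * y) ^ 2 + b * (t * x + (1 - t) * y) + k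
    - (t * (a * x ^ 2 + b * x + k) + (1 - t) * (a * y ^ 2 + b * y + k))
    = - a * (t * (1 - t)) * (x - y) ^ 2) by ring.
  assert (0 < - a * (t * (1 - t)) * (x - y) ^ 2); [|lra].
  apply Rmult_lt_0_compat; [repeat apply Rmult_lt_0_compat; lra|].
  rewrite <- Rsqr_pow2; apply Rlt_0_sqr; lra.
Qed.

Lemma INR_div_pos (N : nat) (c : R) : (2 <= N)%nat -> 0 < c -> 0 < INR N / c.
Proof. intros HN Hc; apply Rdiv_lt_0_compat; [apply lt_0_INR; lia|exact Hc]. Qed.

(** [Fdev] and [Gagg] together contribute [3 / 2 * (N / c) * p] and harm removes
    [N / c * (1 - v) * p], so [v] shifts the linear coefficient and with it the peak. *)
Lemma profit_flip_quadratic (N : nat) (c w v p : R) :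
  0 < c ->
  profit (flip_economy N c w) v p
  = - (INR N / c) * p ^ 2 + INR N / c * (1 / 2 + v) * p + - (v ^ 2 + v).
Proof. intros Hc; unfold profit, investment; simpl; field; lra. Qed.

(** [Ddup] is built to absorb the quadratic term of [wedge_integral], so that welfare minus profit
    is [p - p ^ 2] for all [N] and [c]. *)
Lemma welfare_flip_quadratic (N : nat) (c w v p : R) :
  0 < c ->
  welfare (flip_economy N c w) v p
  = - (INR N / c + 1) * p ^ 2 + (INR N / c * (1 / 2 + v) + 1) * p + - (v ^ 2 + v).
Proof. intros Hc; unfold welfare, investment; simpl; field; lra. Qed.

Lemma standing_flip_economy (N : nat) (c w : R) :
  (2 <= N)%nat -> 0 < c -> 0 <= w < 1 -> standing (flip_economy N c w).
Proof.
  intros HN Hc Hw; assert (HM := INR_div_pos N c HN Hc).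
  (* Each primitive is fitted to [a * x ^ 2 + b * x + k], so one lemma supplies all derivatives;
     [F1] to [F3] serve [Gagg] too, the same function as [Fdev]. *)
  destruct (quadratic_deriv_on nneg (fun x => 3 / 4 * x) 0 (3 / 4) 0 nneg_dense_in_itself
    ltac:(intros; cbv beta; field; lra)) as [F1 [F2 F3]].
  destruct (quadratic_deriv_on unit_itv (fun p => p) 0 1 0 unit_itv_dense_in_itself
    ltac:(intros; cbv beta; field; lra)) as [R1 [R2 R3]].
  destruct (quadratic_deriv_on unit_itv (fun _ => 0) 0 0 0 unit_itv_dense_in_itself
    ltac:(intros; cbv beta; field; lra)) as [[Z1 _] [Z2 _]].
  destruct (quadratic_deriv_on unit_itv (fun p => INR N / c * p) 0 (INR N / c) 0
    unit_itv_dense_in_itself ltac:(intros; cbv beta; field; lra)) as [[H1 _] [H2 _]].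
  destruct (quadratic_deriv_on unit_itv (fun p => (INR N / (2 * c) + 1) * p ^ 2 - p)
    (INR N / (2 * c) + 1) (-1) 0
    unit_itv_dense_in_itself ltac:(intros; cbv beta; field; lra)) as [[D1 _] _].
  destruct (quadratic_deriv_on unit_itv (fun v => v ^ 2 + v) 1 1 0
    unit_itv_dense_in_itself ltac:(intros; cbv beta; field; lra)) as [K1 [K2 K3]].
  constructor; simpl; try assumption; try exact F1; try lra;
    try (intros x Sx; rewrite ?F3, ?R3, ?K3, ?F2, ?R2, ?Z2, ?H2, ?K2 by exact Sx;
         unfold unit_itv in *; lra).
  intros v _; apply (quadratic_strictly_concave01 _ _ _ _ (fun q => profit_flip_quadratic N c w v q Hc)); lra.
Qed.

Lemma objectives_concave_flip_economy (N : nat) (c w v : R) :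
  (2 <= N)%nat -> 0 < c ->
  objectives_concave (flip_economy N c w) v.
Proof.
  intros HN Hc; assert (HM := INR_div_pos N c HN Hc).
  split; apply strictly_concave01_concave01.
  - apply (quadratic_strictly_concave01 _ _ _ _ (fun q => profit_flip_quadratic N c w v q Hc)); lra.
  - apply (quadratic_strictly_concave01 _ _ _ _ (fun q => welfare_flip_quadratic N c w v q Hc)); lra.
Qed.

Lemma deriv_on_profit_flip_economy (N : nat) (c w v p : R) :
  0 < c -> unit_itv p ->
  deriv_on unit_itv (profit (flip_economy N c w) v) p
  = INR N / c * (1 / 2 + v - 2 * p).
Proof.
  intros Hc Up.
  rewrite (proj1 (proj2 (quadratic_deriv_on unit_itv _ _ _ _ unit_itv_dense_in_itself
    (fun q => profit_flip_quadratic N c w v q Hc))) p Up); ring.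
Qed.

Lemma wedge_flip_economy (N : nat) (c w v p : R) :
  0 < c -> unit_itv p -> wedge (flip_economy N c w) v p = 1 - 2 * p.
Proof.
  intros Hc Up; unfold wedge; rewrite deriv_on_profit_flip_economy by assumption.
  rewrite (proj1 (proj2 (quadratic_deriv_on unit_itv _ _ _ _ unit_itv_dense_in_itself
    (fun q => welfare_flip_quadratic N c w v q Hc))) p Up); ring.
Qed.

Theorem proposition5 :
  (forall (E : economy) (v : R),
     standing E -> unit_itv v -> objectives_concave E v ->
     (* the wedge is well defined and has the stated closed form *)
     (derivable_on unit_itv (profit E v) /\
      derivable_on unit_itv (welfare E v) /\
      forall p, unit_itv p ->
        wedge E v p =
          INR (Ndev E) * deriv_on unit_itv (rret E) p * investment E p
          + (1 - omega E) * deriv_on unit_itv (Tleak E) p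
          - deriv_on unit_itv (Ddup E) p) /\
     (* 1 *)
     ((forall p, 0 <= p < 1 -> 0 <= wedge E v p) ->
      forall pP pS, private_level E v pP -> social_level E v pS -> pP <= pS) /\
     (* 2 *)
     ((forall p, 0 <= p < 1 -> wedge E v p <= 0) ->
      forall pP pS, private_level E v pP -> social_level E v pS -> pS <= pP) /\
     (* 3: a sign-changing wedge is compatible with either strict ordering *)
     (wedge_changes_sign E v ->
      (exists E1, standing E1 /\ objectives_concave E1 v /\
         same_wedge_primitives E E1 /\ strictly_too_closed E1 v) /\
      (exists E2, standing E2 /\ objectives_concave E2 v /\
         same_wedge_primitives E E2 /\ strictly_too_open E2 v)) /\
     (* strictness in 1 and 2 *)
     ((forall p, 0 <= p < 1 -> 0 < wedge E v p) ->
      forall pP pS, private_level E v pP -> social_level E v pS ->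
        (0 < pP < 1 \/ 0 < pS < 1) -> pP < pS) /\
     ((forall p, 0 <= p < 1 -> wedge E v p < 0) ->
      forall pP pS, private_level E v pP -> social_level E v pS ->
        (0 < pP < 1 \/ 0 < pS < 1) -> pS < pP)) /\
  (* 3, within one economy: the ordering may flip as v varies *)
  (forall (N : nat) (c w : R), (2 <= N)%nat -> 0 < c -> 0 <= w < 1 ->
     exists E : economy,
       Ndev E = N /\ cinv E = c /\ omega E = w /\ standing E /\
       (forall v, unit_itv v -> objectives_concave E v /\ wedge_changes_sign E v) /\
       (exists v, unit_itv v /\ strictly_too_closed E v) /\
       (exists v, unit_itv v /\ strictly_too_open E v)).
Proof.
  split.
  - intros E v HE Uv HO; repeat split.
    + apply derivable_on_profit, HE.
    + apply derivable_on_welfare, HE.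
    + intros p Up; apply wedge_formula; assumption.
    + intros Hw pP pS; apply private_le_social; assumption.
    + intros Hw pP pS; apply social_le_private; assumption.
    + apply (tilt_both_orderings E v); assumption.
    + apply (tilt_both_orderings E v); assumption.
    + intros Hw pP pS HP HS Hint.
      (* Either the ordering is already strict, or the optima coincide and are interior, where the
         wedge would vanish. *)
      destruct (private_le_social E v pP pS HE Uv (fun p Hp => Rlt_le _ _ (Hw p Hp)) HP HS)
        as [|<-]; [assumption|].
      assert (Hp : 0 < pP < 1) by tauto.
      specialize (Hw pP ltac:(lra)).
      rewrite (wedge_zero_of_common_level E v pP) in Hw by assumption; lra.
    + intros Hw pP pS HP HS Hint.
      destruct (social_le_private E v pP pS HE Uv (fun p Hp => Rlt_le _ _ (Hw p Hp)) HP HS)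
        as [ | ->]; [assumption|].
      assert (Hp : 0 < pP < 1) by tauto.
      specialize (Hw pP ltac:(lra)).
      rewrite (wedge_zero_of_common_level E v pP) in Hw by assumption; lra.
  - intros N c w HN Hc Hw; exists (flip_economy N c w).
    assert (HE := standing_flip_economy N c w HN Hc Hw).
    assert (HO := fun v => objectives_concave_flip_economy N c w v HN Hc).
    assert (U : forall p, 0 <= p <= 1 -> unit_itv p) by trivial.
    repeat (split; [first [reflexivity | exact HE]|]); split; [|split].
    (* The wedge [1 - 2 * p] equals 1 at 0 and -1/2 at 3/4. *)
    + intros v Uv; split; [apply HO|split; [exists 0|exists (3 / 4)]];
        rewrite wedge_flip_economy by (assumption || (apply U; lra)); lra.
    + exists 0; split; [apply U; lra|].
      (* At [v = 0] profit peaks at 1/4, where the wedge is 1/2. *)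
      apply (strictly_too_closed_of_wedge _ 0 (1 / 4)); try apply U; auto; try lra.
      * rewrite deriv_on_profit_flip_economy by (assumption || (apply U; lra)); lra.
      * rewrite wedge_flip_economy by (assumption || (apply U; lra)); lra.
    + exists 1; split; [apply U; lra|].
      (* At [v = 1] profit peaks at 3/4, where the wedge is -1/2. *)
      apply (strictly_too_open_of_wedge _ 1 (3 / 4)); try apply U; auto; try lra.
      * rewrite deriv_on_profit_flip_economy by (assumption || (apply U; lra)); lra.
      * rewrite wedge_flip_economy by (assumption || (apply U; lra)); lra.
Qed.
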